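(* Let $\theta\in[0,2\pi)$ and let $\rho:\pi_1\to SL_2(\mathbb{R})$ be a representation whose character lies in the geometric component, with cone angle $\theta$, of the relative character variety of the generalised four holed sphere, so that $\rho(\alpha\beta)$ and $\rho(\beta\gamma)$ are hyperbolic and there are positive real numbers $\ell_{\alpha\beta},\ell_{\beta\gamma}$ with $$\operatorname{tr}\rho(\alpha\beta)=-2\cosh(\ell_{\alpha\beta}/2),\qquad \operatorname{tr}\rho(\beta\gamma)=-2\cosh(\ell_{\beta\gamma}/2).$$ Then $$\sinh(\ell_{\alpha\beta}/4)\,\sinh(\ell_{\beta\gamma}/4)\ \geq\ \cos(\theta/4).$$
   Context: Let $S$ be a sphere with four points removed. Its fundamental group $\pi_1=\langle\alpha,\beta,\gamma,\delta\mid\delta=\gamma\beta\alpha\rangle$ is freely generated by three simple peripheral loops $\alpha,\beta,\gamma$ around three of the punctures, chosen so that $\delta=\gamma\beta\alpha$ is a peripheral loop around the fourth. A hyperbolic structure on the three-punctured sphere with a single cone point of angle $\theta\in(0,2\pi)$ is a complete hyperbolic metric on the thrice-punctured sphere with cusps at the three punctures $\alpha,\beta,\gamma$, smooth except at one point (corresponding to $\delta$), where it has a cone singularity of angle $\theta$; by convention $\theta=0$ means a cusp at $\delta$. Its holonomy is the holonomy representation of the hyperbolic metric on the complement $S$ of the cone point, lifted to $\rho:\pi_1\to SL_2(\mathbb{R})$ so that $\operatorname{tr}\rho(\alpha)=\operatorname{tr}\rho(\beta)=\operatorname{tr}\rho(\gamma)=2$; then $\operatorname{tr}\rho(\delta)=2\cos(\theta/2)$.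 The relative character variety (for angle $\theta$) is the set of characters $\eta\mapsto\operatorname{tr}\rho(\eta)$ of representations $\rho:\pi_1\to SL_2(\mathbb{R})$ for which $\rho(\alpha),\rho(\beta),\rho(\gamma)$ are parabolic with trace $2$ and $\operatorname{tr}\rho(\delta)=2\cos(\theta/2)$, with the topology of pointwise convergence. Its geometric component is the connected component containing the holonomy of a hyperbolic structure on the three-punctured sphere with cusps at the three punctures $\alpha,\beta,\gamma$ and a single cone point of angle $\theta$ corresponding to $\delta$ (a cusp at $\delta$ if $\theta=0$), lifted to $SL_2(\mathbb{R})$ so that $\alpha,\beta,\gamma$ have trace $2$. An element of $SL_2(\mathbb{R})$ is hyperbolic if its trace has absolute value greater than $2$. *)

(* Defs.v *)
(* MathComp and MathComp-Analysis, over an arbitrary R : realType. *)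
From HB Require Import structures.
From mathcomp Require Import all_boot all_order all_algebra.
From mathcomp Require Import all_classical all_reals all_analysis.
From mathcomp Require Import complex.
Import Order.TTheory GRing.Theory Num.Theory numFieldNormedType.Exports.

Set Implicit Arguments.
Unset Strict Implicit.
Unset Printing Implicit Defensive.

Local Open Scope classical_set_scope.
Local Open Scope ring_scope.
Local Open Scope complex_scope.

Section Hyperbolic_functions.
Variable R : realType.

Definition cosh (x : R) : R := (expR x + expR (- x)) / 2.
Definition sinh (x : R) : R := (expR x - expR (- x)) / 2.

End Hyperbolic_functions.

Section Special_linear_group.
Variable R : realType.

Record SL2 := MkSL2 { SL2_mx :> 'M[R]_2; SL2_det : \det SL2_mx == 1 }.

HB.instance Definition _ := [isSub for SL2_mx].
HB.instance Definition _ := [Choice of SL2 by <:].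

Fact SL2_one_subproof : \det (1%:M : 'M[R]_2) == 1.
Proof. by rewrite det1. Qed.

Fact SL2_mul_subproof (A B : SL2) : \det (A *m B) == 1.
Proof. by rewrite det_mulmx (eqP (SL2_det A)) (eqP (SL2_det B)) mulr1. Qed.

Fact SL2_inv_subproof (A : SL2) : \det (invmx A) == 1.
Proof. by rewrite det_inv (eqP (SL2_det A)) invr1. Qed.

Definition SL2_one := MkSL2 SL2_one_subproof.
Definition SL2_mul A B := MkSL2 (SL2_mul_subproof A B).
Definition SL2_inv A := MkSL2 (SL2_inv_subproof A).

Fact SL2_mulA : associative SL2_mul.
Proof. by move=> A B C; apply/val_inj; rewrite /= mulmxA. Qed.

Fact SL2_mul1 : left_id SL2_one SL2_mul.
Proof. by move=> A; apply/val_inj; rewrite /= mul1mx. Qed.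

Fact SL2_mulr1 : right_id SL2_one SL2_mul.
Proof. by move=> A; apply/val_inj; rewrite /= mulmx1. Qed.

Fact SL2_mulV : left_inverse SL2_one SL2_inv SL2_mul.
Proof.
by move=> A; apply/val_inj; rewrite /= mulVmx // unitmxE (eqP (SL2_det A)) unitr1.
Qed.

Fact SL2_mulrV : right_inverse SL2_one SL2_inv SL2_mul.
Proof.
by move=> A; apply/val_inj; rewrite /= mulmxV // unitmxE (eqP (SL2_det A)) unitr1.
Qed.

HB.instance Definition _ :=
  isGroup.Build SL2 SL2_mulA SL2_mul1 SL2_mulr1 SL2_mulV SL2_mulrV.

Definition hyperbolic (A : SL2) : Prop := 2 < `|\tr A|.

Definition parabolic (A : SL2) : Prop :=
  [/\ `|\tr A| = 2, (A : 'M[R]_2) <> 1%:M & (A : 'M[R]_2) <> - 1%:M].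

Definition mobius (A : SL2) (z : R[i]) : R[i] :=
  ((A ord0 ord0)%:C * z + (A ord0 ord_max)%:C) /
  ((A ord_max ord0)%:C * z + (A ord_max ord_max)%:C).

End Special_linear_group.

Definition freely_generated (G : groupType) (a b c : G) : Prop :=
  forall (H : groupType) (x y z : H),
    (exists f : {multiplicative G -> H}, [/\ f a = x, f b = y & f c = z]) /\
    (forall f g : {multiplicative G -> H},
       f a = g a -> f b = g b -> f c = g c -> f =1 g).

Section Four_holed_sphere.
Variable R : realType.

Definition sphere : Type := one_point_compactification (R * R)%type.
HB.instance Definition _ := Topological.on sphere.

(* Any four points with a standard system of peripheral loops give the same
   marked surface up to homeomorphism. *)
Definition punct_a : R * R := (-1, 0).
Definition punct_b : R * R := (0, 1).
Definition punct_c : R * R := (1, 0).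

Definition four_holed : set sphere :=
  [set x | [/\ x <> Some punct_a, x <> Some punct_b, x <> Some punct_c
             & x <> None]].

(* With a positive cone angle the cone point, at infinity, belongs to the
   hyperbolic surface; with angle 0 it is a fourth cusp and does not. *)
Definition cone_surface (theta : R) : set sphere :=
  [set x | four_holed x \/ 0 < theta /\ x = None].

Definition basepoint : sphere := Some (0, 0).

(* The loop t |-> p (1 - e^(2 pi i t)) with R * R read as the complex plane:
   the circle of centre p through the origin, counterclockwise, which for each
   of the three finite punctures p surrounds p and no other puncture.  The three
   circles are homotopic to lassos leaving 0 in the counterclockwise cyclic order
   c, b, a.  Hence, the first factor of a product being run first, the product
   c b a is homotopic to a simple loop around infinity. *)
Definition circle_around (p : R * R) (t : R) : sphere :=
  let u := 1 - cos (2 * pi * t) in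
  let v := - sin (2 * pi * t) in
  Some (p.1 * u - p.2 * v, p.1 * v + p.2 * u).

(* The hyperbolic cosine of the distance from z to w in the upper half-plane. *)
Definition cosh_dist (z w : R[i]) : R :=
  1 + ((complex.Re z - complex.Re w) ^+ 2 + (complex.Im z - complex.Im w) ^+ 2)
      / (2 * complex.Im z * complex.Im w).

Section Metric.
Variables (X : set sphere) (d : sphere -> sphere -> R).

(* f is an isometry from some ball of (X, d) around x onto a ball of the
   hyperbolic plane. *)
Definition hyperbolic_chart (x : sphere) (f : sphere -> R[i]) : Prop :=
  exists r : R,
  [/\ 0 < r,
      forall y, X y -> d x y < r -> 0 < complex.Im (f y),
      forall y z, X y -> X z -> d x y < r -> d x z < r ->
        cosh (d y z) = cosh_dist (f y) (f z)
    & forall w, 0 < complex.Im w -> cosh_dist (f x) w < cosh r ->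
        exists y, [/\ X y, d x y < r & f y = w]].

(* Near p the metric is that of the quotient of a horoball y0 < Im z by
   z |-> z + 1; the displayed distance is the quotient one because two points
   have nearest lifts with real parts at most 1/2 apart. *)
Definition cusp (p : sphere) : Prop :=
  exists (y0 : R) (c : R[i] -> sphere),
  [/\ 0 < y0,
      forall z, y0 < complex.Im z -> X (c z) /\ c (z + 1) = c z,
      forall z w, y0 < complex.Im z -> y0 < complex.Im w ->
        `|complex.Re z - complex.Re w| <= 2^-1 ->
        cosh (d (c z) (c w)) = cosh_dist z w
    & forall y, y0 <= y ->
        \forall u \near p^', exists2 z, y < complex.Im z & u = c z].

(* Around p the metric is that of a hyperbolic disc sector of angle theta with
   its two sides glued, in polar coordinates; the displayed distance, given by
   the hyperbolic law of cosines, is the cone one because theta < 2 pi and two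
   points have polar angles at most theta/2 apart modulo theta. *)
Definition cone_point (theta : R) (p : sphere) : Prop :=
  exists (e : R) (c : R -> R -> sphere),
  [/\ 0 < e,
      forall r t, 0 <= r < e -> X (c r t) /\ c r (t + theta) = c r t,
      forall t, c 0 t = p,
      forall r1 t1 r2 t2, 0 <= r1 < e -> 0 <= r2 < e ->
        `|t1 - t2| <= theta / 2 ->
        cosh (d (c r1 t1) (c r2 t2)) =
          cosh r1 * cosh r2 - sinh r1 * sinh r2 * cos (t1 - t2)
    & forall x, X x -> d p x < e ->
        exists r t, 0 <= r < e /\ x = c r t].

Definition distance_on : Prop :=
  [/\ forall x y, X x -> X y -> 0 <= d x y,
      forall x y, X x -> X y -> (d x y = 0 <-> x = y),
      forall x y, X x -> X y -> d x y = d y x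
    & forall x y z, X x -> X y -> X z -> d x z <= d x y + d y z].

Definition induces_topology : Prop :=
  forall (x : sphere) (A : set sphere), X x ->
    nbhs x A <-> exists2 r : R, 0 < r & forall y, X y -> d x y < r -> A y.

Definition complete_on : Prop :=
  forall u : nat -> sphere, (forall n, X (u n)) ->
    (forall e : R, 0 < e ->
       exists N, forall m n, (N <= m)%N -> (N <= n)%N -> d (u m) (u n) < e) ->
    exists2 x, X x & d (u n) x @[n --> \oo] --> (0 : R).

(* For a complete, locally compact distance this says that d x y is the infimum
   of the lengths of the paths from x to y. *)
Definition has_midpoints : Prop :=
  forall x y, X x -> X y ->
    exists m, [/\ X m, d x m = d x y / 2 & d m y = d x y / 2].

(* F t is a hyperbolic chart at l t, and its germ is continued along the path l,
   starting from the germ of f and ending with that of g. *)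
Definition continuation (l : R -> sphere) (f g : sphere -> R[i]) : Prop :=
  exists F : R -> sphere -> R[i],
  [/\ forall t, 0 <= t <= 1 -> hyperbolic_chart (l t) (F t),
      forall t, 0 <= t <= 1 -> exists2 e : R, 0 < e &
        forall s, 0 <= s <= 1 -> `|s - t| < e ->
          \forall u \near l s, F s u = F t u,
      \forall u \near l 0, F 0 u = f u
    & \forall u \near l 1, F 1 u = g u].

End Metric.

(* The complete hyperbolic structures on the three-punctured sphere with three
   cusps and one cone point of angle theta (a cusp if theta = 0), given by their
   path metrics. *)
Definition hyperbolic_cone_structure (theta : R) (d : sphere -> sphere -> R) :
    Prop :=
  let X := cone_surface theta in
  [/\ [/\ distance_on X d, induces_topology X d, complete_on X d
        & has_midpoints X d],
      forall x, four_holed x -> exists f, hyperbolic_chart X d x f,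
      [/\ cusp X d (Some punct_a), cusp X d (Some punct_b)
        & cusp X d (Some punct_c)],
      0 < theta -> cone_point X d theta None
    & theta = 0 -> cusp X d None].

Section Characters.
Variables (G : groupType) (a b c : G).

(* Continuing a chart f along a loop eta yields rho(eta) o f.  This is
   multiplicative for the product in which the first factor is run first, so it
   is enough to ask it of the three generators. *)
Definition is_holonomy (theta : R) (d : sphere -> sphere -> R)
    (rho : {multiplicative G -> SL2 R}) : Prop :=
  let X := cone_surface theta in
  exists f : sphere -> R[i],
  [/\ hyperbolic_chart X d basepoint f,
      continuation X d (circle_around punct_a) f (mobius (rho a) \o f),
      continuation X d (circle_around punct_b) f (mobius (rho b) \o f)
    & continuation X d (circle_around punct_c) f (mobius (rho c) \o f)].

Definition trace_char (rho : {multiplicative G -> SL2 R}) :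
    {ptws G -> R} := fun g => \tr (rho g).

Definition parabolic_trace2 (A : SL2 R) : Prop := parabolic A /\ \tr A = 2.

Definition relative_character_variety (theta : R) : set {ptws G -> R} :=
  [set chi | exists rho : {multiplicative G -> SL2 R},
    [/\ parabolic_trace2 (rho a), parabolic_trace2 (rho b),
        parabolic_trace2 (rho c),
        \tr (rho (c * b * a)%g) = 2 * cos (theta / 2)
      & chi = trace_char rho]].

Definition geometric_component (theta : R) : set {ptws G -> R} :=
  [set chi | exists (d : sphere -> sphere -> R)
                    (rho0 : {multiplicative G -> SL2 R}),
    [/\ hyperbolic_cone_structure theta d, is_holonomy theta d rho0,
        [/\ \tr (rho0 a) = 2, \tr (rho0 b) = 2 & \tr (rho0 c) = 2]
      & connected_component (relative_character_variety theta)
          (trace_char rho0) chi]].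

End Characters.
End Four_holed_sphere.

(* Main.v *)
Require Import Defs.
From mathcomp Require Import all_boot all_order all_algebra.
From mathcomp Require Import all_classical all_reals all_analysis.
From mathcomp Require Import ring lra.
Import Order.TTheory GRing.Theory Num.Theory.
Local Open Scope ring_scope.

(** With traces 2 at three of the boundary loops and 4 k - 2 at the fourth, where
    k = cos^2 (theta / 4), the Fricke relation of the four-holed sphere is a
    quadratic equation in z = tr rho(alpha gamma) with coefficients depending on
    x = tr rho(alpha beta) and y = tr rho(beta gamma).  Writing x = - 2 - 4 S and
    y = - 2 - 4 T, where S and T are the squares of the two hyperbolic sines, its
    discriminant is 256 (1 + S) (1 + T) (S T - k).  It is nonnegative because z is
    real, so S T >= k. *)

Section TraceIdentities.
Variable F : comNzRingType.

Lemma mxtrace2 (A : 'M[F]_2) : \tr A = A 0 0 + A 1 1.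
Proof. by rewrite /mxtrace big_ord_recl big_ord1; congr (_ + A _ _); apply/val_inj. Qed.

Lemma mulmx2E (A B : 'M[F]_2) i j : (A *m B) i j = A i 0 * B 0 j + A i 1 * B 1 j.
Proof.
by rewrite mxE big_ord_recl big_ord1; congr (_ + A _ _ * B _ _); apply/val_inj.
Qed.

Lemma det_mx2E (A : 'M[F]_2) : \det A = A 0 0 * A 1 1 - A 0 1 * A 1 0.
Proof.
rewrite (expand_det_row _ 0) big_ord_recl big_ord1 /cofactor !det_mx11 !mxE /=.
rewrite expr0 expr1 mul1r mulN1r mulrN.
by congr (_ * A _ _ - A _ _ * A _ _); apply/val_inj.
Qed.

(** Polarizing Cayley-Hamilton in size 2 expresses [A *m B + B *m A] through traces; multiplying by
    [C] and taking the trace gives this identity, with no condition on determinants. *)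
Lemma mxtrace_mul3_sum (A B C : 'M[F]_2) :
  \tr (A *m B *m C) + \tr (A *m C *m B) =
    \tr A * \tr (B *m C) + \tr B * \tr (A *m C) + \tr C * \tr (A *m B)
    - \tr A * \tr B * \tr C.
Proof. by rewrite !mxtrace2 !mulmx2E; ring. Qed.

(** Together with the sum, this makes the traces of [A *m B *m C] and [A *m C *m B] the two roots of
    a quadratic; eliminating the second trace gives the Fricke relation. *)
Lemma mxtrace_mul3_prod (A B C : 'M[F]_2) :
  \det A = 1 -> \det B = 1 -> \det C = 1 ->
  \tr (A *m B *m C) * \tr (A *m C *m B) =
    \tr A ^+ 2 + \tr B ^+ 2 + \tr C ^+ 2
    + \tr (A *m B) ^+ 2 + \tr (B *m C) ^+ 2 + \tr (A *m C) ^+ 2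
    - \tr A * \tr B * \tr (A *m B) - \tr B * \tr C * \tr (B *m C)
    - \tr A * \tr C * \tr (A *m C)
    + \tr (A *m B) * \tr (B *m C) * \tr (A *m C) - 4.
Proof.
move=> dA dB dC.
(* Homogenizing by determinants gives an identity valid for all 2x2 matrices. *)
transitivity
  (\tr A ^+ 2 * \det B * \det C + \tr B ^+ 2 * \det A * \det C
   + \tr C ^+ 2 * \det A * \det B
   + \tr (A *m B) ^+ 2 * \det C + \tr (B *m C) ^+ 2 * \det A
   + \tr (A *m C) ^+ 2 * \det B
   - \tr A * \tr B * \tr (A *m B) * \det C
   - \tr B * \tr C * \tr (B *m C) * \det A
   - \tr A * \tr C * \tr (A *m C) * \det B
   + \tr (A *m B) * \tr (B *m C) * \tr (A *m C)
   - 4 * \det A * \det B * \det C).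
  by rewrite !det_mx2E !mxtrace2 !mulmx2E; ring.
by rewrite dA dB dC; ring.
Qed.

End TraceIdentities.

(** Completing the square: a root [z] of [z ^+ 2 + p * z + q] satisfies
    [(2 * z + p) ^+ 2 = p ^+ 2 - 4 * q], here with [p = (2 + 4 * S) * (2 + 4 * T) - 8 * k]. *)
Lemma fricke_discriminant (F : comNzRingType) (A B C : 'M[F]_2) (S T k : F) :
  \det A = 1 -> \det B = 1 -> \det C = 1 ->
  \tr A = 2 -> \tr B = 2 -> \tr C = 2 ->
  \tr (A *m B *m C) = 4 * k - 2 ->
  \tr (B *m C) = - 2 - 4 * S -> \tr (A *m B) = - 2 - 4 * T ->
  (2 * \tr (A *m C) + (2 + 4 * S) * (2 + 4 * T) - 8 * k) ^+ 2 =
    256 * ((1 + S) * (1 + T) * (S * T - k)).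
Proof.
move=> dA dB dC tA tB tC tABC tBC tAB.
have := mxtrace_mul3_prod _ A B C dA dB dC.
have := mxtrace_mul3_sum _ A B C.
rewrite tABC tBC tAB tA tB tC; set z := \tr (A *m C); set w := \tr _ => sum prod.
have {sum} wE : w = 2 * (- 2 - 4 * S) + 2 * z + 2 * (- 2 - 4 * T) - 8 - (4 * k - 2).
  by apply: (addrI (4 * k - 2)); rewrite sum; ring.
move: prod; rewrite wE => /eqP; rewrite -subr_eq0 => /eqP prod.
(* The quadratic in [z] enters [prod] with leading coefficient -1, and completing its square
   multiplies it by 4; hence the factor -4. *)
apply/eqP; rewrite -subr_eq0 -[X in _ == X](mulr0 (- 4)) -prod; apply/eqP.
by ring.
Qed.

Section HyperbolicFunctions.
Variable R : realType.

Lemma cosh_double (x : R) : cosh (x + x) = 1 + 2 * sinh x ^+ 2.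
Proof.
rewrite /cosh /sinh opprD !expRD.
have e : expR x * expR (- x) = 1 by rewrite -expRD subrr expR0.
by field: e.
Qed.

Lemma sinh_gt0 (x : R) : 0 < x -> 0 < sinh x.
Proof. by move=> x0; rewrite divr_gt0 // subr_gt0 ltr_expR; lra. Qed.

End HyperbolicFunctions.

Theorem theorem1p3p1 (R : realType) (pi1 : groupType)
    (alpha beta gamma : pi1)
    (pi1_free : freely_generated alpha beta gamma)
    (theta : R) (theta_ge0 : 0 <= theta) (theta_lt2pi : theta < 2 * pi)
    (rho : {multiplicative pi1 -> SL2 R})
    (rho_geom : geometric_component alpha beta gamma theta (trace_char rho))
    (hyp_ab : hyperbolic (rho (alpha * beta)%g))
    (hyp_bc : hyperbolic (rho (beta * gamma)%g))
    (l_ab l_bc : R) (l_ab_gt0 : 0 < l_ab) (l_bc_gt0 : 0 < l_bc)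
    (tr_ab : \tr (rho (alpha * beta)%g) = - (2 * cosh (l_ab / 2)))
    (tr_bc : \tr (rho (beta * gamma)%g) = - (2 * cosh (l_bc / 2))) :
  cos (theta / 4) <= sinh (l_ab / 4) * sinh (l_bc / 4).
Proof.
case: rho_geom => d [rho0 [_ _ _ /connected_component_sub]].
case=> rho' [[_ ta] [_ tb] [_ tc] td chiE].
have trE g : \tr (rho' g) = \tr (rho g) by have /(congr1 (@^~ g)) := chiE.
move: ta tb tc td; rewrite !trE !gmulfM /= => ta tb tc td.
(* The boundary word is [gamma * beta * alpha], so the pair products are reversed to match [A], [B],
   [C] taken in that order. *)
move: tr_ab tr_bc; rewrite !gmulfM /= mxtrace_mulC => tr_ab.
rewrite mxtrace_mulC => tr_bc.
have half2 (x : R) : x / 2 = x / 4 + x / 4 by field.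
rewrite half2 cosh_double in tr_ab; rewrite half2 cosh_double in tr_bc.
rewrite half2 cosD -!expr2 sin2cos2 in td.
have s0 : 0 < sinh (l_ab / 4) by apply: sinh_gt0; lra.
have t0 : 0 < sinh (l_bc / 4) by apply: sinh_gt0; lra.
move: s0 t0 tr_ab tr_bc td.
set s := sinh (l_ab / 4); set t := sinh (l_bc / 4); set c := cos (theta / 4).
move=> s0 t0 tr_ab tr_bc td.
have := @fricke_discriminant R (rho gamma) (rho beta) (rho alpha)
  (s ^+ 2) (t ^+ 2) (c ^+ 2) (eqP (SL2_det _)) (eqP (SL2_det _)) (eqP (SL2_det _))
  tc tb ta.
rewrite td tr_ab tr_bc => /(_ ltac:(ring) ltac:(ring) ltac:(ring)) disc.
have : 0 <= 256 * ((1 + s ^+ 2) * (1 + t ^+ 2) * (s ^+ 2 * t ^+ 2 - c ^+ 2)).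
  by rewrite -disc sqr_ge0.
rewrite pmulr_rge0 // pmulr_rge0; last by rewrite mulr_gt0 // ltr_pwDl // sqr_ge0.
rewrite subr_ge0 -exprMn => le_sqr.
have st0 : 0 <= s * t by rewrite mulr_ge0 // ltW.
(* Comparing squares bounds the absolute value of [c] by [s * t], and hence [c] itself. *)
by rewrite (le_trans (ler_norm c)) // -(ger0_norm st0) -ler_sqr ?nnegrE //
  !real_normK ?num_real.
Qed.
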